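(* Let $R$ be a commutative ring with identity, $\sigma$ a finite linearly ordered index set, and $K$ a commutative $R$-algebra, in which zeros are taken. Let $PS\subseteq R[X_i]_{i\in\sigma}$ be a set of polynomials, let $CS=(c_1,\ldots,c_r)$ be a characteristic set of $PS$, and let $IP=\prod_{i=1}^r I_{c_i}$ be the initial product of $CS$. Then \[ \operatorname{Zero}(CS/IP)\subseteq \operatorname{Zero}(PS), \] and consequently \[ \operatorname{Zero}(CS/IP)=\operatorname{Zero}(PS/IP). \] Moreover, \[ \operatorname{Zero}(PS)=\operatorname{Zero}(CS/IP)\cup\Bigl(\bigcup_{p\in CS}\operatorname{Zero}(PS\cup\{I_p\})\Bigr). \]
   Context: Variables are ordered by $X_i<X_j$ whenever $i<j$. The main variable of a nonconstant polynomial $p\in R[X_i]_{i\in\sigma}$ is the greatest variable appearing in $p$; constants have no main variable (formally, their main-variable index is $\bot$, smaller than every element of $\sigma$). Initial: if $p$ is nonconstant with main variable $X_i$ and $p=c_dX_i^d+\cdots+c_0$ with $c_k\in R[X_j]_{j<i}$ and $c_d\neq 0$, then the initial of $p$ is $I_p=\operatorname{init}(p)=c_d$. The initial of $0$ is $0$, and the initial of a nonzero constant is $1$. Triangular set: a finite set of nonzero polynomials that can be arranged as a sequence $s_1,\ldots,s_r$ whose main-variable indices are strictly increasing; $s_1$ is allowed to be a nonzero constant. A triangular set is always written in this order. For a triangular set $S=(s_1,\ldots,s_k)$ and a polynomial $g$, ''$\operatorname{remdr}(g/S)=0$'' means that $0$ is a pseudo-remainder of $g$ with respect to $S$, i.e.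 there exist $e_1,\ldots,e_k\in\mathbb N$ and $q_1,\ldots,q_k\in R[X_i]_{i\in\sigma}$ with $\bigl(\prod_{i=1}^k I_{s_i}^{e_i}\bigr)g=\sum_{i=1}^k q_is_i$. Zero sets: for a set $P$ of polynomials, $\operatorname{Zero}(P)\subseteq K^\sigma$ is the set of common zeros in $K^\sigma$ of all elements of $P$ (evaluated via the $R$-algebra structure of $K$). For a polynomial $h$, $\operatorname{Zero}(P/h)=\operatorname{Zero}(P)\setminus\operatorname{Zero}(\{h\})$. Characteristic set: a triangular set $CS$ is a characteristic set of $PS$ if (1) $\operatorname{remdr}(p/CS)=0$ for every $p\in PS$, and (2) $\operatorname{Zero}(PS)\subseteq\operatorname{Zero}(CS)$.
   Formalization: K is assumed to be a nonzero algebra without zero divisors (an integral domain); for arbitrary commutative R-algebras the claim fails, e.g. R = K = Z/4, PS = {X}, CS = (2X). *)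

(* Defs.v *)
From HB Require Import structures.
From mathcomp Require Import all_boot all_order all_algebra finmap.
From mathcomp Require Import boolp classical_sets.
From mathcomp.multinomials Require Import monalg.

Set Implicit Arguments.
Unset Strict Implicit.
Unset Printing Implicit Defensive.

Import Order.TTheory GRing.Theory.
Local Open Scope ring_scope.

(* R[X_i]_{i in sigma}: the monoid algebra of the commutative monomials
   over sigma; a monomial m is a function sigma -> nat of exponents. *)
Notation poly_in R sigma := {malg R[{cmonom sigma}]}.

Section Initials.
Context {d : Order.disp_t} {sigma : finOrderType d} {R : comNzRingType}.
Implicit Types (p : poly_in R sigma) (i : sigma).

Definition vars p : {set sigma} :=
  [set i | has (fun m : {cmonom sigma} => m i != 0%N) (msupp p)].

(* None plays the role of the index "bottom" of the constants. *)
Definition mainvar p : option sigma :=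
  [pick i in vars p | [forall j in vars p, (j <= i)%O]].

Definition mainvar_lt (u v : option sigma) : bool :=
  match u, v with
  | _, None => false
  | None, Some _ => true
  | Some i, Some j => (i < j)%O
  end.

Definition degin i p : nat := \max_(m <- msupp p) m i.

(* The coefficient of X_i ^ k in p viewed as a polynomial in X_i: the terms of
   p of degree k in X_i, with their monomials divided by X_i ^ k. *)
Definition coefin i (k : nat) p : poly_in R sigma :=
  \sum_(m <- msupp p | (m : {cmonom sigma}) i == k)
     << p@_m *g divcm m (expcmn (ucm i) k) >>.

Definition init p : poly_in R sigma :=
  if p == 0 then 0
  else if mainvar p is Some i then coefin i (degin i p) p else 1.

(* The sequence is the (unique) increasing arrangement of a triangular set. *)
Definition triangular (S : seq (poly_in R sigma)) : Prop :=
  all (fun s => s != 0) S /\ sorted (fun s t => mainvar_lt (mainvar s) (mainvar t)) S.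

Definition remdr0 (g : poly_in R sigma) (S : seq (poly_in R sigma)) : Prop :=
  exists (e : 'I_(size S) -> nat) (q : 'I_(size S) -> poly_in R sigma),
    (\prod_(i < size S) init S`_i ^+ e i) * g = \sum_(i < size S) q i * S`_i.

End Initials.

Section Zeros.
Context {d : Order.disp_t} {sigma : finOrderType d} {R : comNzRingType}.
Variable K : comAlgType R.
Implicit Types (P : set (poly_in R sigma)) (h : poly_in R sigma).
Local Open Scope classical_set_scope.

Definition peval (x : sigma -> K) (p : poly_in R sigma) : K :=
  mmap (GRing.in_alg K) (fun m : {cmonom sigma} => \prod_(i : sigma) x i ^+ m i) p.

Definition Zero P : set (sigma -> K) := [set x | forall p, P p -> peval x p = 0].

Definition Zero_off P h : set (sigma -> K) := Zero P `\` Zero [set h].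

Definition charset (PS : set (poly_in R sigma)) (CS : seq (poly_in R sigma)) : Prop :=
  [/\ triangular CS,
      forall p, PS p -> remdr0 p CS
    & Zero PS `<=` Zero [set` CS]].

End Zeros.

Arguments peval {d sigma R} K x p.
Arguments Zero {d sigma R} K P _.
Arguments Zero_off {d sigma R} K P h _.
Arguments charset {d sigma R} K PS CS.

(* Main.v *)
Require Import Defs.
From HB Require Import structures.
From mathcomp Require Import all_boot all_order all_algebra finmap.
From mathcomp Require Import boolp classical_sets.
From mathcomp.multinomials Require Import monalg.

Set Implicit Arguments.
Unset Strict Implicit.
Unset Printing Implicit Defensive.

Import Order.TTheory GRing.Theory.
Local Open Scope ring_scope.
Local Open Scope classical_set_scope.

Section Evaluation.
Context {d : Order.disp_t} {sigma : finOrderType d} {R : comNzRingType}.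
Variables (K : comAlgType R) (x : sigma -> K).

(** Evaluation at [x] is a ring morphism, so an identity witnessing [remdr0 g CS] can be evaluated
    at a zero [x] of [CS]: its right side vanishes. If [IP] does not vanish at [x], neither does any
    initial, and since [K] has no zero divisors [g] must vanish ([peval_remdr0]). Conversely, zeros
    of [PS] are zeros of [CS] by definition; those where [IP] vanishes kill some single initial
    ([prod_eq0_domain]), which yields the decomposition. *)

Definition monom_eval (m : {cmonom sigma}) : K := \prod_(i : sigma) x i ^+ m i.

Lemma monom_eval_mmorphism : mmorphism monom_eval.
Proof.
split=> [m n|]; rewrite /monom_eval.
  by rewrite -big_split /=; apply: eq_bigr => i _; rewrite cmM exprD.
by rewrite big1 // => i _; rewrite cm1 expr0.
Qed.

HB.instance Definition _ :=
  monalg.isMultiplicative.Build {cmonom sigma} K monom_eval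
    monom_eval_mmorphism.

(** A multiplicative map on monomials extends to a ring morphism on the monoid algebra; [peval]
    unfolds to this extension and inherits its structure. *)
HB.instance Definition _ := GRing.RMorphism.copy (peval K x)
  (mmap (GRing.in_alg K) monom_eval).

Hypothesis K_domain : forall a b : K, a * b = 0 -> a = 0 \/ b = 0.

Lemma prod_eq0_domain (T : eqType) (s : seq T) (F : T -> K) :
  \prod_(t <- s) F t = 0 <-> exists2 t, t \in s & F t = 0.
Proof.
split=> [|[t ts Ft0]]; last by rewrite (big_rem t ts) /= Ft0 mul0r.
elim: s => [|t s IHs]; first by rewrite big_nil => /eqP; rewrite oner_eq0.
rewrite big_cons => /K_domain[Ft0|/IHs[u us Fu0]].
  by exists t; rewrite ?mem_head.
by exists u; rewrite ?in_cons ?us ?orbT.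
Qed.

(** The case [n = 0] holds vacuously, since [1] is nonzero in [K]; exponents in [remdr0] may be
    zero. *)
Lemma expr_eq0_domain (a : K) n : a ^+ n = 0 -> a = 0.
Proof.
elim: n => [|n IHn]; first by move/eqP; rewrite expr0 oner_eq0.
by rewrite exprS => /K_domain[|/IHn].
Qed.

Lemma peval_remdr0 (S : seq (poly_in R sigma)) (g : poly_in R sigma) :
  remdr0 g S -> (forall s, s \in S -> peval K x s = 0) ->
  (forall s, s \in S -> peval K x (init s) <> 0) -> peval K x g = 0.
Proof.
move=> [e [q eq_g]] S0 initS_neq0; move/(congr1 (peval K x)): eq_g.
rewrite rmorphM rmorph_prod rmorph_sum /= [RHS]big1 => [|i _]; last first.
  by rewrite rmorphM /= (S0 S`_i) ?mulr0 //; exact: mem_nth.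
(* Either [g] vanishes at [x], or some power of an initial does, which is excluded. *)
case/K_domain=> // /prod_eq0_domain[i _].
by rewrite rmorphXn => /expr_eq0_domain/initS_neq0[]; exact: mem_nth.
Qed.

End Evaluation.

Theorem theorem5 (d : Order.disp_t) (sigma : finOrderType d)
  (R : comNzRingType) (K : comAlgType R)
  (K_domain : forall a b : K, a * b = 0 -> a = 0 \/ b = 0)
  (PS : set (poly_in R sigma)) (CS : seq (poly_in R sigma))
  (CS_charset : charset K PS CS) :
  let IP := \prod_(c <- CS) init c in
  [/\ Zero_off K [set` CS] IP `<=` Zero K PS,
      Zero_off K [set` CS] IP = Zero_off K PS IP
    & Zero K PS = Zero_off K [set` CS] IP `|`
        \bigcup_(p in [set` CS]) Zero K (PS `|` [set init p])].
Proof.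
case: CS_charset => _ remCS sub_PS_CS IP.
have IPE x : peval K x IP = \prod_(c <- CS) peval K x (init c).
  exact: rmorph_prod.
have IP_neq0 x : ~ Zero K [set IP] x ->
    forall c, c \in CS -> peval K x (init c) <> 0.
  move=> IPx c cCS c0; apply: IPx => _ ->.
  by rewrite IPE; apply/(prod_eq0_domain K_domain); exists c.
have sub_CS_PS : Zero_off K [set` CS] IP `<=` Zero K PS.
  move=> x [CSx IPx] p PSp.
  exact: (peval_remdr0 K_domain (remCS p PSp) CSx (IP_neq0 x IPx)).
split=> //; apply/seteqP; split=> x.
- by move=> CSx; split; [exact: sub_CS_PS | case: CSx].
- by case=> PSx IPx; split=> //; exact: sub_PS_CS.
(* Split the zeros of [PS] by whether [IP] vanishes there. *)
- move=> PSx; have [IPx|IPx] := pselect (Zero K [set IP] x); last first.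
    by left; split=> //; exact: sub_PS_CS.
  right; have := IPx IP erefl; rewrite IPE.
  move/(prod_eq0_domain K_domain)=> [c cCS c0]; exists c => //.
  by move=> p [/PSx //|->].
(* Adding an initial to [PS] can only shrink the zero set. *)
- case=> [/sub_CS_PS //|[c _ cx] p PSp].
  by apply: cx; left.
Qed.
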